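(* Let $\Gamma$ be a discrete subring of $\mathbb{C}$ (containing $1$), let $K$ be the subfield of $\mathbb{C}$ generated by $\Gamma$, and let $f:\mathbb{C}\to\Gamma$ be a map with $|\zeta-f(\zeta)|\leq 1$ for all $\zeta\in\mathbb{C}$. Suppose that the fundamental set $\{\zeta-f(\zeta)\mid \zeta\in\mathbb{C}\setminus K\}$ of $f$ is contained in the closed ball of radius $r$ centered at $0$, where $0<r<1$. Let $z\in\mathbb{C}\setminus K$, define $z_0=z$, $z_{n+1}=(z_n-f(z_n))^{-1}$ for $n\ge 0$, let $a_n=f(z_n)$ ($n\ge0$), and let $\{p_n\},\{q_n\}$ be the $\mathcal{Q}$-pair of $\{a_n\}$. Then (i) $q_n\neq 0$ for all $n\geq 0$ and $p_n/q_n\to z$ as $n\to\infty$; and (ii) for every $n$ with $|q_{n-1}|<|q_n|$, $\left|z-\frac{p_n}{q_n}\right|\leq \frac{r}{1-r}|q_n|^{-2}$.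
   Context: For a sequence $\{a_n\}_{n\ge0}$ of complex numbers, its $\mathcal{Q}$-pair is defined by $p_{-1}=1$, $p_0=a_0$, $p_{n+1}=a_{n+1}p_n+p_{n-1}$ and $q_{-1}=0$, $q_0=1$, $q_{n+1}=a_{n+1}q_n+q_{n-1}$ for all $n\geq 0$. (For $z\notin K$ all $z_n\notin K$, so $z_n-f(z_n)\neq 0$ and the sequence is well defined.) *)

(* Defs.v *)
From HB Require Import structures.
From mathcomp Require Import all_boot all_order all_algebra.
From mathcomp Require Import complex.
From mathcomp Require Import all_classical all_reals all_analysis.

Set Implicit Arguments.
Unset Strict Implicit.
Unset Printing Implicit Defensive.

Import Order.TTheory GRing.Theory Num.Theory numFieldNormedType.Exports.

Local Open Scope classical_set_scope.
Local Open Scope ring_scope.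
Local Open Scope complex_scope.

Definition is_subring (R : realType) (A : set R[i]) : Prop :=
  GRing.subring_closed [pred x in A].

(* In the field R[i], where 0^-1 = 0, [divring_closed] means: contains 1 and is
   closed under x - y and x / y. *)
Definition is_subfield (R : realType) (A : set R[i]) : Prop :=
  GRing.divring_closed [pred x in A].

Definition generated_subfield (R : realType) (A : set R[i]) : set R[i] :=
  smallest (@is_subfield R) A.

(* The regular algebra R[i]^o is R[i] with the topology of the modulus; R[i]
   itself carries no canonical topology in the library. *)
Definition is_discrete (R : realType) (A : set R[i]) : Prop :=
  A `<=` isolated (A : set R[i]^o).

Definition fundamental_set (R : realType) (K : set R[i]) (f : R[i] -> R[i]) :
    set R[i] :=
  [set w - f w | w in ~` K].

Definition cf_iter (R : realType) (f : R[i] -> R[i]) (z : R[i]) (n : nat) :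
    R[i] :=
  iter n (fun w => (w - f w)^-1) z.

(* Indices of the Q-pair are shifted by one, to start at 0 rather than -1:
   [Qpair_p a n] is p_{n-1} and [Qpair_q a n] is q_{n-1}. *)
Fixpoint Qpair_p (R : realType) (a : nat -> R[i]) (n : nat) : R[i] :=
  match n with
  | 0 => 1
  | m.+1 => match m with
            | 0 => a 0%N
            | k.+1 => a m * Qpair_p a m + Qpair_p a k
            end
  end.

Fixpoint Qpair_q (R : realType) (a : nat -> R[i]) (n : nat) : R[i] :=
  match n with
  | 0 => 0
  | m.+1 => match m with
            | 0 => 1
            | k.+1 => a m * Qpair_q a m + Qpair_q a k
            end
  end.

(* Main.v *)
Require Import Defs.
From HB Require Import structures.
From mathcomp Require Import all_boot all_order all_algebra.
From mathcomp Require Import complex ring.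
From mathcomp Require Import all_classical all_reals all_analysis.

Set Implicit Arguments.
Unset Strict Implicit.

Import Order.TTheory GRing.Theory Num.Theory numFieldNormedType.Exports.

Local Open Scope classical_set_scope.
Local Open Scope ring_scope.
Local Open Scope complex_scope.

(** Write [w_n = z_n - a_n] and [e_n = q_n z - p_n].  Then [e_n = - w_n e_(n-1)],
    so [|e_n| <= r^(n+1)], and [e_(n-1) (q_(n-1) w_n + q_n) = +-1].  A nonzero
    element of a discrete subring has modulus at least [1], since its powers
    would otherwise accumulate at [0].  Hence [q_n = 0] would make [p_n = - e_n] an
    element of [Gamma] of modulus in ]0, 1[, which is absurd; so [|q_n| >= 1]
    and [|z - p_n / q_n| <= r^(n+1)].  If [|q_(n-1)| < |q_n|], the second
    identity gives [(1 - r) |e_(n-1)| |q_n| <= 1], whence (ii). *)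

(** The order of [R[i]] is partial, but elements comparable with 0 are real, so [s] and [e] may be
    replaced by their real parts; what remains is geometric decay in [R]. *)
Lemma near_expr_lt_complex (R : realType) (s e : R[i]) :
  0 <= s -> s < 1 -> 0 < e -> \forall n \near \oo, s ^+ n < e.
Proof.
move=> s0 s1 e0.
have es : (complex.Re s)%:C = s by apply: RRe_real; apply: ger0_real.
have ee : (complex.Re e)%:C = e by apply: RRe_real; apply: gtr0_real.
move: s0 s1 e0; rewrite -es -ee; move: (complex.Re s) (complex.Re e) => t d.
rewrite -[0]/(0%:C) -[1]/(1%:C) lecR !ltcR => t0 t1 d0.
have t_lt1 : `|t| < 1 by rewrite ger0_norm.
have /cvgrPdist_lt/(_ _ d0) := cvg_expr t_lt1.
apply: filterS => n; rewrite sub0r normrN ger0_norm ?exprn_ge0 // => tnd.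
by rewrite -rmorphXn ltcR.
Qed.

Lemma subring_closure (R : realType) (A : set R[i]) : is_subring A ->
  [/\ A 1, forall x y, A x -> A y -> A (x - y)
     & forall x y, A x -> A y -> A (x * y)].
Proof.
move=> [A1 AB AM]; split; first by move: A1; rewrite !inE.
- by move=> x y Ax Ay; have := AB x y; rewrite !inE; apply.
- by move=> x y Ax Ay; have := AM x y; rewrite !inE; apply.
Qed.

Lemma subfield_closure (R : realType) (A : set R[i]) : is_subfield A ->
  [/\ A 1, forall x y, A x -> A y -> A (x - y)
     & forall x y, A x -> A y -> A (x / y)].
Proof.
move=> [A1 AB AM]; split; first by move: A1; rewrite !inE.
- by move=> x y Ax Ay; have := AB x y; rewrite !inE; apply.
- by move=> x y Ax Ay; have := AM x y; rewrite !inE; apply.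
Qed.

Lemma discrete_subring_norm_ge1 (R : realType) (A : set R[i]) (x : R[i]) :
  is_subring A -> is_discrete A -> A x -> x != 0 -> 1 <= `|x|.
Proof.
move=> /subring_closure[A1 AB AM] Adisc Ax x0.
rewrite real_leNgt ?realE ?ler01 ?normr_ge0 //; apply/negP => x1.
have A0 : A 0 by rewrite -(subrr 1); exact: AB.
have AX n : A (x ^+ n) by elim: n => // n IH; rewrite exprS; exact: AM.
have [_ [V /nbhs_ballP [e e0 eV] VA]] := Adisc 0 A0.
have [N _ /(_ N (leqnn N))] := @near_expr_lt_complex R _ _ (normr_ge0 x) x1 e0.
rewrite /= -normrX => xNe.
have : (V `&` (A : set R[i]^o)) (x ^+ N).
  split; last exact: AX.
  by apply: eV; rewrite -ball_normE /ball_ /= sub0r normrN; exact: xNe.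
(* Since 0 is isolated, V meets A only at 0, which forces x^N = 0. *)
by rewrite VA /= => /eqP; rewrite expf_eq0 (negPf x0) andbF.
Qed.

Lemma Qpair_in_subring (R : realType) (A : set R[i]) (a : nat -> R[i]) :
  is_subring A -> (forall n, A (a n)) ->
  forall n, A (Qpair_p a n) /\ A (Qpair_q a n).
Proof.
move=> /subring_closure[A1 AB AM] Aa.
have A0 : A 0 by rewrite -(subrr 1); exact: AB.
have AD x y : A x -> A y -> A (x + y).
  move=> Ax Ay; rewrite -[y]opprK -[- y]sub0r; apply: (AB) => //; exact: AB.
suff H n : (A (Qpair_p a n) /\ A (Qpair_q a n)) /\
           (A (Qpair_p a n.+1) /\ A (Qpair_q a n.+1)) by move=> n; case: (H n).
elim: n => [|n [[pn qn] [pn1 qn1]]]; first by do !split => //=.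
by do !split => //; apply: (AD) => //; apply: (AM).
Qed.

(** With x = (w - b)^-1 one has w = b + 1/x, so x in K would put w in K. By induction this keeps
    every z_n outside K and every w_n nonzero. *)
Lemma generated_subfield_cf_step (R : realType) (A : set R[i]) (b w : R[i]) :
  A b -> ~ generated_subfield A w ->
  w - b != 0 /\ ~ generated_subfield A (w - b)^-1.
Proof.
move=> Ab Kw.
suff H : ~ generated_subfield A (w - b)^-1.
  split=> //; apply/eqP => wb0; apply: Kw => B [_ AB].
  have -> : w = b by apply/eqP; rewrite -subr_eq0 wb0.
  exact: AB.
move=> Kx; apply: Kw => B BA.
have Bx := Kx B BA; have [/subfield_closure[B1 BB BV] AB] := BA.
have Bb := AB _ Ab.
(* No case split on w = b is needed, because 0^-1 = 0. *)
have Bd : B (w - b) by rewrite -[w - b]invrK -div1r; exact: BV.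
(* Closure is available for differences only, so (w - b) + b is spelled with subtractions and 1 - 1
   stands for 0. *)
have -> : w = w - b - (1 - 1 - b) by ring.
apply: (BB) => //; apply: (BB) => //; exact: BB.
Qed.

Section ContinuedFraction.
Variables (R : realType) (f : R[i] -> R[i]) (z : R[i]).

Let w n := cf_iter f z n - f (cf_iter f z n).
Let a n := f (cf_iter f z n).
Let P n := Qpair_p a n.
Let Q n := Qpair_q a n.

Hypothesis w_neq0 : forall n, w n != 0.

(** Because of the index shift, [Q n * z - P n] is e_(n-1). The errors obey the recurrence of the
    Q-pair, e_(n+1) = a_(n+1) e_n + e_(n-1); inserting e_(n-1) = - e_n / w_n leaves the coefficient
    a_(n+1) - 1/w_n = - w_(n+1). *)
Lemma Qpair_error_rec n :
  Q n.+1 * z - P n.+1 = - w n * (Q n * z - P n).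
Proof.
elim: n => [|n IH]; first by rewrite /P /Q /w /a /cf_iter /=; ring.
have -> : Q n.+2 = a n.+1 * Q n.+1 + Q n by [].
have -> : P n.+2 = a n.+1 * P n.+1 + P n by [].
have wE : w n.+1 = (w n)^-1 - a n.+1 by [].
have IH' : Q n * z - P n = - (w n)^-1 * (Q n.+1 * z - P n.+1).
  by rewrite IH mulNr mulNr mulrN opprK mulKf.
rewrite wE; transitivity (a n.+1 * (Q n.+1 * z - P n.+1) + (Q n * z - P n)).
  by ring.
by rewrite IH'; ring.
Qed.

Lemma Qpair_error_norm_le (s : R[i]) n : (forall n, `|w n| <= s) ->
  `|Q n * z - P n| <= s ^+ n.
Proof.
move=> ws; elim: n => [|n IH].
  by rewrite /Q /P /= mul0r sub0r normrN normr1.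
by rewrite Qpair_error_rec normrM normrN exprS ler_pM.
Qed.

Lemma Qpair_error_neq0 n : Q n * z - P n != 0.
Proof.
elim: n => [|n IH]; first by rewrite /Q /P /= mul0r sub0r oppr_eq0 oner_eq0.
by rewrite Qpair_error_rec mulf_neq0 // oppr_eq0.
Qed.

(** Since w_(n+1) = 1/w_n - a_(n+1), the terms in a_(n+1) cancel and the second factor is divided by
    w_n at each step, while the first is multiplied by - w_n; the product only changes sign. *)
Lemma Qpair_error_det n :
  (Q n * z - P n) * (Q n * w n + Q n.+1) = (-1) ^+ n.+1.
Proof.
elim: n => [|n IH]; first by rewrite /P /Q /=; ring.
have -> : Q n.+2 = a n.+1 * Q n.+1 + Q n by [].
have wE : w n.+1 = (w n)^-1 - a n.+1 by [].
rewrite exprS -IH Qpair_error_rec wE.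
transitivity (- (Q n * z - P n) * (Q n.+1 * (w n * (w n)^-1) + Q n * w n)).
  by ring.
by rewrite divff //; ring.
Qed.

Lemma Qpair_error_mul_le (s : R[i]) n :
  s < 1 -> (forall n, `|w n| <= s) -> `|Q n| < `|Q n.+1| ->
  `|Q n.+1 * z - P n.+1| * `|Q n.+1| <= s / (1 - s).
Proof.
move=> s1 ws Qlt.
have s0 : 0 <= s by apply: le_trans (ws 0%N).
have ds : 0 < 1 - s by rewrite subr_gt0.
rewrite ler_pdivlMr // Qpair_error_rec normrM normrN -!mulrA.
(* The bound splits into |w_n| <= s and |e_(n-1)| |q_n| (1 - s) <= 1. *)
rewrite -[leRHS]mulr1 ler_pM ?mulr_ge0 ?normr_ge0 // ?(ltW ds) //.
have det1 : `|(Q n * z - P n) * (Q n * w n + Q n.+1)| = 1.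
  by rewrite Qpair_error_det normrX normrN1 expr1n.
(* After cancelling |e_(n-1)|, it remains that |q_n + q_(n-1) w_n| >= |q_n| - |q_(n-1)| |w_n| >= (1
   - s) |q_n|. *)
rewrite -[leRHS]det1 normrM ler_wpM2l // [Q n * w n + _]addrC -[Q n * w n]opprK.
apply: le_trans (lerB_dist _ _); rewrite normrN normrM mulrBr mulr1 lerB //.
by rewrite ler_pM // ltW.
Qed.

End ContinuedFraction.

Unset Implicit Arguments.

Theorem theorem2p4 (R : realType) (Gamma : set R[i]) (f : R[i] -> R[i])
    (r : R) (z : R[i])
    (Gamma_subring : is_subring Gamma)
    (Gamma_discrete : is_discrete Gamma)
    (f_Gamma : forall w : R[i], Gamma (f w))
    (f_near : forall w : R[i], `|w - f w| <= 1)
    (r_gt0 : 0 < r) (r_lt1 : r < 1)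
    (f_fund : fundamental_set (generated_subfield Gamma) f `<=`
                closed_ball_ Num.norm 0 r%:C)
    (z_notin : ~ generated_subfield Gamma z) :
  let a := fun n : nat => f (cf_iter f z n) in
  let p := fun n : nat => Qpair_p a n.+1 in
  let q := fun n : nat => Qpair_q a n.+1 in
  ((forall n : nat, q n <> 0) /\
   (p n / q n : R[i]^o) @[n --> \oo] --> (z : R[i]^o)) /\
  (forall n : nat, `|Qpair_q a n| < `|Qpair_q a n.+1| ->
     `|z - p n / q n| <= (r / (1 - r))%:C * `|q n| ^- 2).
Proof.
move=> a p q.
have zK n : ~ generated_subfield Gamma (cf_iter f z n).
  by elim: n => // n IH; case: (generated_subfield_cf_step (f_Gamma (cf_iter f z n)) IH).
have w0 n : cf_iter f z n - f (cf_iter f z n) != 0.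
  by case: (generated_subfield_cf_step (f_Gamma (cf_iter f z n)) (zK n)).
have wr n : `|cf_iter f z n - f (cf_iter f z n)| <= r%:C.
  have /f_fund : fundamental_set (generated_subfield Gamma) f
    (cf_iter f z n - f (cf_iter f z n)) by exists (cf_iter f z n) => //; exact: zK.
  by rewrite /closed_ball_ /= sub0r normrN.
have rC0 : 0 <= r%:C by rewrite -[0]/(0%:C) lecR ltW.
have rC1 : r%:C < 1 by rewrite -[1]/(1%:C) ltcR.
have Gpq := Qpair_in_subring (a := a) Gamma_subring (fun n => f_Gamma _).
have q_neq0 n : q n != 0.
  apply/eqP => qn0.
  have := Qpair_error_norm_le w0 n.+1 wr.
  have := Qpair_error_neq0 w0 n.+1.
  rewrite -/a -/(q n) qn0 mul0r sub0r oppr_eq0 normrN => pn0 pn_le.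
  have := discrete_subring_norm_ge1 Gamma_subring Gamma_discrete
    (Gpq _).1 pn0.
  rewrite real_leNgt ?realE ?ler01 ?normr_ge0 // => /negP; apply.
  (* The exponent is n + 1, hence positive, and the bound is strictly below 1 even for n = 0. *)
  by apply: le_lt_trans pn_le _; rewrite exprn_ilt1.
have q_ge1 n : 1 <= `|q n|.
  exact: (discrete_subring_norm_ge1 Gamma_subring Gamma_discrete
    (Gpq n.+1).2 (q_neq0 n)).
have errE n : `|z - p n / q n| = `|q n * z - p n| / `|q n|.
  by rewrite -normf_div mulrBl mulrAC divff // mul1r.
split; [split=> [n|]|move=> n qlt].
- exact/eqP.
- apply/cvgrPdist_lt => e e0.
  apply: filterS (near_expr_lt_complex rC0 rC1 e0) => n.
  apply: le_lt_trans.
  have -> : `|(z : R[i]^o) - p n / q n| = `|q n * z - p n| / `|q n| by exact: errE.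
  rewrite ler_pdivrMr ?normr_gt0 //.
  apply: le_trans (Qpair_error_norm_le w0 n.+1 wr) _.
  (* Here r^(n+1) <= r^n and 1 <= |q_n| are multiplied. *)
  rewrite -[leLHS]mulr1 ler_pM ?exprn_ge0 //.
  by rewrite exprS ler_piMl ?exprn_ge0 // ltW.
- rewrite errE ler_pdivrMr ?normr_gt0 // expr2 invfM mulrA mulfVK ?normr_eq0 //.
  rewrite ler_pdivlMr ?normr_gt0 //.
  have -> : (r / (1 - r))%:C = r%:C / (1 - r%:C) by rewrite fmorph_div rmorphB.
  exact: (Qpair_error_mul_le w0 rC1 wr qlt).
Qed.
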